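(* Let $(\xi_n)_{n\ge1}$ be a sequence of independent random variables, where $\xi_n$ takes the values $\frac12$ and $1$ with probabilities $p_{(\frac12)n}$ and $p_{(1)n}=1-p_{(\frac12)n}$ respectively, and let $\xi=[\xi_1;\xi_2;\dots;\xi_n;\dots]$ be the random variable defined by the corresponding infinite continued fraction. Suppose there exist numbers $M\in\mathbb{Z}_+$, $L\in\mathbb{N}$ and stochastic vectors $(q_{(\frac12)j},q_{(1)j})$, $j\in\{1,2,\dots,L\}$, such that $$p_{(\frac12)(M+jL+i)}=q_{(\frac12)i}\qquad\forall j\in\mathbb{Z}_+,\ i\in\{1,2,\dots,L\}.$$ If there exists $j\in\{1,2,\dots,L\}$ with $q_{(\frac12)j}\in(0,1)$, and $$\prod_{j=1}^{L}\left(q_{(\frac12)j}\right)^{\frac{\ln\frac{25}{24}}{\ln\frac{10}{9}}}\left(q_{(1)j}\right)^{1-\frac{\ln\frac{25}{24}}{\ln\frac{10}{9}}}\neq e^{-2GL},\qquad\text{where}\quad G=-\int_{1/2}^{1}\frac{\ln x}{\ln\left(\frac{10}{9}\right)(x+1)(x+2)}\,dx,$$ then the distribution of $\xi$ is singular.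
   Context: For a sequence $(a_n)$ of positive reals, $[a_1;a_2;\dots;a_k]$ denotes the finite continued fraction $\cfrac{1}{a_1+\cfrac{1}{a_2+\dots+\cfrac{1}{a_k}}}$, and $[a_1;a_2;\dots;a_k;\dots]=\lim_{k\to\infty}[a_1;\dots;a_k]$ (the limit exists whenever $\sum a_n$ diverges, in particular when all $a_n\in\{\frac12,1\}$). $\mathbb{Z}_+=\{0,1,2,\dots\}$. A stochastic vector is a vector with nonnegative entries summing to $1$, so $q_{(\frac12)j}+q_{(1)j}=1$. A distribution is singular if its distribution function is continuous (no atoms) and the distribution is concentrated on a set of Lebesgue measure zero. *)

(* Defs.v *)
From HB Require Import structures.
From mathcomp Require Import all_boot all_order all_algebra finmap.
From mathcomp Require Import all_classical all_reals all_analysis.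
From mathcomp Require Import measurable_realfun.

Set Implicit Arguments.
Unset Strict Implicit.
Unset Printing Implicit Defensive.

Import Order.TTheory GRing.Theory Num.Theory.
Import numFieldTopology.Exports numFieldNormedType.Exports.

Local Open Scope classical_set_scope.
Local Open Scope ring_scope.

(* Mutual independence: product rule over every finite subfamily. *)
Definition independent_RVs (d d' : measure_display) (T : measurableType d)
    (T' : measurableType d') (R : realType) (P : probability T R)
    (I : choiceType) (X : I -> {RV P >-> T'}) : Prop :=
  forall (J : {fset I}) (B : I -> set T'),
    (forall i, i \in J -> measurable (B i)) ->
    P (\bigcap_(i in [set` J]) (X i @^-1` B i)) =
    (\prod_(i <- J) P (X i @^-1` B i))%E.

(* cfrac [:: a_1; ...; a_k] = 1 / (a_1 + 1 / (a_2 + ... + 1 / a_k)); there is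
   no leading integer part. *)
Definition cfrac (R : realType) (s : seq R) : R :=
  foldr (fun a x => (a + x)^-1) 0 s.

(* Sequences are indexed from 0: [a 0; a 1; ...]. *)
Definition inf_cfrac (R : realType) (a : R^nat) : R :=
  limn (fun k => cfrac (mkseq a k)).

Section measurability.
Context (d : measure_display) (T : measurableType d) (R : realType).

Lemma measurable_invr : measurable_fun [set: R] (@GRing.inv R).
Proof.
have -> : @GRing.inv R = fun x => if x == 0 then 0 else x^-1.
  by apply/funext => x; case: eqP => // ->; rewrite invr0.
apply: measurable_fun_if => //.
  by apply: measurable_fun_eqr.
rewrite setTI (_ : _ @^-1` _ = [set x : R | x != 0]); last first.
  by apply/seteqP; split => x /=; case: eqP.
apply: open_continuous_measurable_fun; first exact: open_neq.
by move=> x; rewrite inE/= => x0; exact: inv_continuous.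
Qed.

Lemma measurable_limn (f : (T -> R)^nat) :
  (forall n, measurable_fun [set: T] (f n)) ->
  measurable_fun [set: T] (fun x => limn (f ^~ x)).
Proof.
move=> mf; pose u n x := (f n x)%:E.
have mu n : measurable_fun [set: T] (u n) by exact/measurable_EFinP/mf.
pose S x := limn_esup (u ^~ x); pose I x := limn_einf (u ^~ x).
have mS : measurable_fun [set: T] S by exact: measurable_fun_limn_esup.
have mI : measurable_fun [set: T] I.
  rewrite /I /limn_einf; apply: measurableT_comp => //.
  apply: (@measurable_fun_limn_esup _ _ _ _ (fun n x => (- u n x)%E)) => n.
  exact: measurableT_comp.
have -> : (fun x => limn (f ^~ x)) =
    fun x => if (S x == I x) && (S x == (fine (S x))%:E) then fine (S x)
             else point.
  apply/funext => x; case: ifPn => [/andP[/eqP SI /eqP Sf]|].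
    apply/cvg_lim => //.
    suff : u ^~ x @ \oo --> (fine (S x))%:E by move/fine_cvgP => [].
    rewrite -Sf; apply: (@squeeze_cvge _ _ _ _ (einfs (u ^~ x)) _
      (esups (u ^~ x))).
    - apply: nearW => n; apply/andP; split.
        by apply: ereal_inf_lbound; exists n => //=.
      by apply: ereal_sup_ubound; exists n => //=.
    - by rewrite SI /I limn_einf_lim; exact: is_cvg_einfs.
    - by rewrite /S limn_esup_lim; exact: is_cvg_esups.
  move=> nSI; apply: dvgP => /cvg_ex[l fl]; move/negP: nSI; apply.
  have ul : u ^~ x @ \oo --> l%:E by apply: cvg_EFin => //; exact: nearW.
  by have [Il Sl] := cvg_limn_einf_sup ul; rewrite /S /I Il Sl/= !eqxx.
have mfS : measurable_fun [set: T] (fun x => fine (S x)).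
  exact: measurableT_comp.
apply: measurable_fun_ifT => //; apply: measurable_and.
  exact: measurable_fun_eqe.
by apply: measurable_fun_eqe => //; exact/measurable_EFinP.
Qed.

Lemma measurable_inf_cfrac (X : nat -> {mfun T >-> R}) :
  measurable_fun [set: T] (fun w => inf_cfrac (X ^~ w)).
Proof.
apply: measurable_limn => k; rewrite /mkseq.
elim: (iota 0 k) => [|i s IH] /=; first exact: measurable_cst.
apply: (measurableT_comp measurable_invr).
exact: measurable_funD.
Qed.

End measurability.

Section cfrac_RV.
Context (d : measure_display) (T : measurableType d) (R : realType)
  (P : probability T R).

Definition cfrac_fun (X : nat -> {RV P >-> R}) : T -> R :=
  fun w => inf_cfrac (X ^~ w).

HB.instance Definition _ (X : nat -> {RV P >-> R}) :=
  isMeasurableFun.Build _ _ _ _ (cfrac_fun X) (measurable_inf_cfrac X).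

Definition cfrac_RV (X : nat -> {RV P >-> R}) : {RV P >-> R} := cfrac_fun X.

End cfrac_RV.

Definition singular_distribution (d : measure_display) (T : measurableType d)
    (R : realType) (P : probability T R) (X : {RV P >-> R}) : Prop :=
  continuous (cdf X) /\
  exists N : set R, [/\ measurable N, lebesgue_measure N = 0%E &
    distribution P X N = 1%E].

(* Mean of - ln x under the density 1 / (ln (10/9) (x+1) (x+2)) on [1/2, 1],
   which is invariant under the shift of the digits {1/2, 1}. *)
Definition Gconst (R : realType) : R :=
  - \int[@lebesgue_measure R]_(x in `[1 / 2, 1])
      (ln x / (ln (10 / 9) * (x + 1) * (x + 2))).

(* Main.v *)
(* Code the digits 1/2, 1 by booleans. On cylinders, Lebesgue measure behaves
   like a digit process: given the first n digits, the next digit is 1/2 with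
   probability (2 + s) / (3 + 2 s), where s is the quotient of consecutive
   continuants, and s depends on the last digit by a fixed amount. The law of xi
   has independent digits, so at the places where q is not degenerate the two
   conditional probabilities of the following digit differ by a definite amount
   with a probability bounded below. Hence the Hellinger affinity
   sum_u sqrt (P(u) |u|) over the cylinders u of rank n decays geometrically
   along an arithmetic progression of ranks, and by Borel-Cantelli the points
   lying in infinitely many of the unions of cylinders with |u| <= P(u) form a
   Lebesgue null set carrying xi. There are no atoms because a point lies in at
   most two cylinders of each rank, whose probabilities tend to zero. *)
Require Import Defs.
From HB Require Import structures.
From mathcomp Require Import all_boot all_order all_algebra finmap.
From mathcomp Require Import all_classical all_reals all_analysis.
From mathcomp Require Import measurable_realfun zify ring lra.

Import Order.TTheory GRing.Theory Num.Theory.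
Import numFieldTopology.Exports numFieldNormedType.Exports.

Local Open Scope classical_set_scope.
Local Open Scope ring_scope.

(** * Digit words, continuants and cylinder lengths *)

Section Words.
Context {R : realType}.
Implicit Types (u : seq bool) (p : nat -> bool -> R).

Definition digit (b : bool) : R := if b then 1 / 2 else 1.

Lemma digit_ge b : 1 / 2 <= digit b.
Proof. by case: b; rewrite /digit; lra. Qed.

Lemma digit_le1 b : digit b <= 1.
Proof. by case: b; rewrite /digit; lra. Qed.

Fixpoint words n : seq (seq bool) :=
  if n is n'.+1 then map (cons true) (words n') ++ map (cons false) (words n')
  else [:: [::]].

Lemma size_words n u : u \in words n -> size u = n.
Proof.
elim: n u => [|n IH] u /=; first by rewrite inE => /eqP ->.
by rewrite mem_cat => /orP[] /mapP[v /IH <- ->].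
Qed.

Lemma mem_words u : u \in words (size u).
Proof.
elim: u => [|b u IH]; first by rewrite inE.
by rewrite /= mem_cat; case: b; rewrite map_f // orbT.
Qed.

Lemma sum_wordsS n (F : seq bool -> R) :
  \sum_(u <- words n.+1) F u =
  \sum_(u <- words n) F (true :: u) + \sum_(u <- words n) F (false :: u).
Proof. by rewrite /= big_cat !big_map. Qed.

(** [words] grows at the front, whereas subdividing a cylinder appends a digit. *)
Lemma sum_words_rcons n (F : seq bool -> R) :
  \sum_(u <- words n.+1) F u =
  \sum_(u <- words n) (F (rcons u true) + F (rcons u false)).
Proof.
elim: n F => [|n IH] F; first by rewrite sum_wordsS !big_seq1.
by rewrite sum_wordsS [RHS]sum_wordsS !IH.
Qed.

Definition weight p u : R := \prod_(i < size u) p i (nth false u i).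

Lemma weight_cons p b u :
  weight p (b :: u) = p 0%N b * weight (fun i => p i.+1) u.
Proof. by rewrite /weight big_ord_recl. Qed.

Lemma weight_rcons p b u : weight p (rcons u b) = weight p u * p (size u) b.
Proof.
rewrite /weight size_rcons big_ord_recr /= nth_rcons ltnn eqxx; congr (_ * _).
by apply: eq_bigr => i _; rewrite nth_rcons ltn_ord.
Qed.

Definition cf_map u (x : R) : R := foldr (fun b y => (digit b + y)^-1) x u.

(** Denominators $q_n, q_{n-1}$ of the last two convergents, from $q_0 = 1$ and $q_{-1} = 0$. *)
Definition continuant u : R * R :=
  foldl (fun s b => (digit b * s.1 + s.2, s.1)) (1, 0) u.

Lemma cf_map_rcons u b x : cf_map (rcons u b) x = cf_map u (digit b + x)^-1.
Proof. by rewrite /cf_map foldr_rcons. Qed.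

Lemma continuant_rcons u b : continuant (rcons u b) =
  (digit b * (continuant u).1 + (continuant u).2, (continuant u).1).
Proof. by rewrite /continuant foldl_rcons. Qed.

Lemma continuantP u :
  [/\ 0 < (continuant u).1, 0 <= (continuant u).2 &
      (continuant u).2 <= 2 * (continuant u).1].
Proof.
elim/last_ind: u => [|u b [q0 q'0 q'q]]; first by rewrite /=; split; lra.
rewrite continuant_rcons /=; have := digit_ge b; split; nra.
Qed.

(** [cf_map u] is a Moebius map of determinant $\pm 1$ with denominator $q + q'x$; induction on the
    last digit avoids its numerator. *)
Lemma cf_map_dist u (x y : R) : 0 <= x -> 0 <= y ->
  `|cf_map u x - cf_map u y| =
  `|x - y| / (((continuant u).1 + (continuant u).2 * x) *
              ((continuant u).1 + (continuant u).2 * y)).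
Proof.
elim/last_ind: u x y => [|u b IH] x y x0 y0.
  by rewrite /= !mul0r !addr0 mulr1 divr1.
have [q0 q'0 _] := continuantP u.
rewrite !cf_map_rcons continuant_rcons /=.
have := digit_ge b; move: (digit b) => a a0.
have ax0 : 0 < a + x by lra.
have ay0 : 0 < a + y by lra.
rewrite IH ?invr_ge0 ?ltW//.
have -> : (a + x)^-1 - (a + y)^-1 = (y - x) / ((a + x) * (a + y)).
  by field; rewrite !gt_eqF.
rewrite normrM normfV (distrC y) (gtr0_norm (mulr_gt0 ax0 ay0)).
move: (continuant u) q0 q'0 => [q q'] /= q0 q'0; field.
rewrite !gt_eqF//= ?andbT; do ?(apply/andP; split => //); nra.
Qed.

(** A new digit turns $q + q'$ into at least $3q/2 + q'$, and $q' \le 2q$ makes this at least $7/6$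
    of the old sum. *)
Lemma continuant_growth u :
  (7 / 6) ^+ size u <= (continuant u).1 + (continuant u).2.
Proof.
elim/last_ind: u => [|u b IH]; first by rewrite /= expr0; lra.
rewrite continuant_rcons size_rcons exprS /=.
have [q0 q'0 q'q] := continuantP u; have := digit_ge b; nra.
Qed.

(* Length of the interval [cf_map u [1/2, 1]]. *)
Definition cyl_length u : R :=
  ((2 * (continuant u).1 + (continuant u).2) *
   ((continuant u).1 + (continuant u).2))^-1.

Definition slope u : R := (continuant u).2 / (continuant u).1.

(* Proportion of a cylinder of slope [s] occupied by its child of digit [b]. *)
Definition share b (s : R) : R :=
  if b then (2 + s) / (3 + 2 * s) else (1 + s) / (3 + 2 * s).

Lemma cyl_length_gt0 u : 0 < cyl_length u.
Proof. by have [q0 q'0 _] := continuantP u; rewrite invr_gt0; nra. Qed.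

Lemma slope_itv u : 0 <= slope u <= 2.
Proof.
have [q0 q'0 q'q] := continuantP u.
by rewrite /slope divr_ge0 ?(ltW q0)//= ler_pdivrMr.
Qed.

Lemma slope_rcons u b : slope (rcons u b) = (digit b + slope u)^-1.
Proof.
have [q0 q'0 _] := continuantP u; have := digit_ge b => a0.
rewrite /slope continuant_rcons /=; field.
by rewrite !gt_eqF//=; nra.
Qed.

Lemma cyl_length_rcons u b :
  cyl_length (rcons u b) = cyl_length u * share b (slope u).
Proof.
have [q0 q'0 _] := continuantP u.
rewrite /cyl_length /share /slope continuant_rcons /=.
move: (continuant u) q0 q'0 => [q q'] /= q0 q'0.
case: b => /=; field; rewrite !gt_eqF//=; do ?(apply/andP; split => //); nra.
Qed.

(** The maps $x \mapsto 1/(1/2+x)$ and $x \mapsto 1/(1+x)$ send $[1/2,1]$ onto $[2/3,1]$ and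
    $[1/2,2/3]$, so the two children tile their parent. *)
Lemma shareD (s : R) : 0 <= s -> share true s + share false s = 1.
Proof. by move=> s0; rewrite /share; field; rewrite gt_eqF//; lra. Qed.

Lemma share_bounds b (s : R) : 0 <= s -> 1 / 3 <= share b s <= 1.
Proof.
move=> s0; have d : 0 < 3 + 2 * s by lra.
by case: b; rewrite /share ler_pdivlMr// ler_pdivrMr//; apply/andP; split; lra.
Qed.

Lemma cf_map_cyl u (x : R) : 1 / 2 <= x <= 1 ->
  `|cf_map u x - cf_map u 1| <= cyl_length u.
Proof.
move=> /andP[x0 x1]; have [q0 q'0 _] := continuantP u.
rewrite cf_map_dist; [|lra|lra].
rewrite /cyl_length mulr1 ler0_norm; last lra.
move: (continuant u) q0 q'0 => [q q'] /= q0 q'0.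
rewrite ler_pdivrMr ?mulr_gt0//; [|nra|nra].
rewrite mulrC ler_pdivlMr ?mulr_gt0//; [|nra|nra].
rewrite mulrA; apply: ler_wpM2r; nra.
Qed.

End Words.

(** * Decay of the Hellinger affinity *)

Section Hellinger.
Context {R : realType}.

(** The affinity is 1 minus half the sum of the squared differences of the square roots, and
    $(p_0-r_0)^2 = (\sqrt{p_0}-\sqrt{r_0})^2(\sqrt{p_0}+\sqrt{r_0})^2$, whose last factor is at most
    4. *)
Lemma affinity_le (p0 p1 r0 r1 : R) : 0 <= p0 -> 0 <= p1 -> 0 <= r0 ->
  0 <= r1 -> p0 + p1 = 1 -> r0 + r1 = 1 ->
  Num.sqrt (p0 * r0) + Num.sqrt (p1 * r1) <= 1 - (p0 - r0) ^+ 2 / 8.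
Proof.
move=> hp0 hp1 hr0 hr1 hp hr; rewrite !sqrtrM//.
have := sqr_sqrtr hp0; have := sqr_sqrtr hp1.
have := sqr_sqrtr hr0; have := sqr_sqrtr hr1.
move: (sqrtr_ge0 p0) (sqrtr_ge0 p1) (sqrtr_ge0 r0) (sqrtr_ge0 r1).
move: (Num.sqrt p0) (Num.sqrt p1) (Num.sqrt r0) (Num.sqrt r1) => a c b d.
move=> a0 c0 b0 d0 Ed Eb Ec Ea.
have b1 : b <= 1 by nra.
have a1 : a <= 1 by nra.
have ab : (a + b) ^+ 2 <= 4 by nra.
have E1 : a * b + c * d = 1 - ((a - b) ^+ 2 + (c - d) ^+ 2) / 2 by nra.
have E2 : (p0 - r0) ^+ 2 = (a - b) ^+ 2 * (a + b) ^+ 2.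
  by rewrite -Ea -Eb; ring.
have := ler_wpM2l (sqr_ge0 (a - b)) ab.
have := sqr_ge0 (c - d); rewrite E1 E2; lra.
Qed.

(* The two values of the latest digit lead to distinct shares of the next
   cylinders, so at least one of them is far from any prescribed [p]. *)
Lemma share_separation (s p : R) : 0 <= s <= 2 ->
  exists b, (1 / 418) ^+ 2 <= (p - share true (digit b + s)^-1) ^+ 2.
Proof.
move=> /andP[s0 s2].
(* The gap is $1/((3s+5)(6s+7))$, least at $s = 2$, where it is $1/(11 \cdot 19)$; half of it is the
   distance $1/418$. *)
have sep : 1 / 209 <= share true (digit false + s)^-1
                      - share true (digit true + s)^-1.
  have -> : share true (digit false + s)^-1 - share true (digit true + s)^-1 =
      1 / ((3 * s + 5) * (6 * s + 7)).
    rewrite /share /digit; field; rewrite !gt_eqF//=; lra.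
  by rewrite !div1r lef_pV2 ?posrE; nra.
have [h|h] := leP (p - share true (digit true + s)^-1) (1 / 418).
  by exists false; rewrite -[leRHS]sqrrN ler_sqr ?nnegrE; lra.
by exists true; rewrite ler_sqr ?nnegrE; lra.
Qed.

Context (p : nat -> bool -> R).
Context (p_ge0 : forall i b, 0 <= p i b).
Context (p_sum : forall i, p i true + p i false = 1).

Lemma weight_ge0 u : 0 <= weight p u.
Proof. by apply: prodr_ge0. Qed.

Definition hell u : R := Num.sqrt (weight p u * cyl_length u).

Definition Hell n : R := \sum_(u <- words n) hell u.

Lemma hell_rcons u b : hell (rcons u b) =
  hell u * Num.sqrt (p (size u) b * share b (slope u)).
Proof.
rewrite /hell weight_rcons cyl_length_rcons -sqrtrM; last first.
  by rewrite mulr_ge0 ?weight_ge0 ?(ltW (cyl_length_gt0 _)).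
by congr Num.sqrt; ring.
Qed.

Lemma children_le_sqr u :
  Num.sqrt (p (size u) true * share true (slope u)) +
  Num.sqrt (p (size u) false * share false (slope u)) <=
  1 - (p (size u) true - share true (slope u)) ^+ 2 / 8.
Proof.
have /andP[s0 _] := slope_itv (R := R) u.
apply: affinity_le => //; last exact: shareD.
- by have /andP[] := share_bounds true _ s0; lra.
- by have /andP[] := share_bounds false _ s0; lra.
Qed.

Lemma children_le u :
  Num.sqrt (p (size u) true * share true (slope u)) +
  Num.sqrt (p (size u) false * share false (slope u)) <= 1.
Proof.
have := children_le_sqr u.
have := sqr_ge0 (p (size u) true - share true (slope u)); lra.
Qed.

Lemma Hell_ge0 n : 0 <= Hell n.
Proof. by apply: sumr_ge0 => u _; exact: sqrtr_ge0. Qed.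

Lemma HellS_le n : Hell n.+1 <= Hell n.
Proof.
rewrite /Hell sum_words_rcons; apply: ler_sum => u _.
by rewrite !hell_rcons -mulrDr ler_piMr ?sqrtr_ge0// children_le.
Qed.

Lemma Hell_le1 n : Hell n <= 1.
Proof.
elim: n => [|n IH]; last exact: le_trans (HellS_le n) IH.
rewrite /Hell big_seq1 /hell.
rewrite /weight big_ord0 mul1r /cyl_length /= -[leRHS]sqrtr1 ler_wsqrtr//.
by rewrite invf_le1; lra.
Qed.

(** Two ranks are needed: the digit at position [n] selects the next slope, and one of its values
    puts [p n.+1 true] at distance at least $1/418$ from the share. That branch shrinks by $1 -
    (1/418)^2/8$, and its part of the affinity is at least $m/3$, as the square root of a number in
    $[0,1]$ is at least that number. *)
Lemma HellSS_le n (m : R) : 0 <= m -> (forall b, m <= p n b) ->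
  Hell n.+2 <= (1 - m / 3 * ((1 / 418) ^+ 2 / 8)) * Hell n.
Proof.
move=> m0 mp; set k := 1 - _; rewrite /Hell !sum_words_rcons mulr_sumr.
rewrite big_seq_cond [leRHS]big_seq_cond.
apply: ler_sum => u; rewrite andbT => /size_words un.
rewrite !hell_rcons -!mulrDr [leRHS]mulrC -!mulrA -!mulrDr.
apply: ler_wpM2l; first exact: sqrtr_ge0.
have s02 := slope_itv (R := R) u; have /andP[s0 _] := s02.
have := children_le u.
have c b : m / 3 <= Num.sqrt (p (size u) b * share b (slope u)).
  have /andP[r0 r1] := share_bounds b _ s0.
  have pb : m <= p (size u) b by rewrite un.
  have p1 : p (size u) b <= 1.
    by have := p_sum (size u); have := p_ge0 (size u); case: b {pb r0 r1} => h;
      have := h true; have := h false; lra.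
  rewrite -[leLHS]ger0_norm ?divr_ge0// -sqrtr_sqr ler_wsqrtr// expr2; nra.
have := c true; have := c false.
move: (Num.sqrt _) (Num.sqrt _) => y x hy hx xy.
have := children_le_sqr (rcons u true).
have := children_le_sqr (rcons u false).
have := children_le (rcons u true).
have := children_le (rcons u false).
have [b] := share_separation _ (p (size u).+1 true) s02.
rewrite !slope_rcons !size_rcons.
set X := Num.sqrt (p _ true * share true (digit true + _)^-1) + _.
set Y := Num.sqrt (p _ true * share true (digit false + _)^-1) + _.
rewrite /k; set e := (1 / 418) ^+ 2.
have e0 : 0 <= e by exact: sqr_ge0.
case: b => hb Y1 X1 Y2 X2.
- have : X <= 1 - e / 8 by lra.
  nra.
- have : Y <= 1 - e / 8 by lra.
  nra.
Qed.

End Hellinger.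

(** * Infinite continued fractions *)

Section Value.
Context {R : realType}.
Implicit Types (b : nat -> bool) (u : seq bool).

Lemma cf_map_cat u v (x : R) : cf_map (u ++ v) x = cf_map u (cf_map v x).
Proof. by rewrite /cf_map foldr_cat. Qed.

Lemma cf_map_itv u (x : R) : 1 / 2 <= x <= 1 -> 1 / 2 <= cf_map u x <= 1.
Proof.
move=> hx; elim: u => [//|b u /andP[IH0 IH1]] /=.
have := digit_ge (R := R) b; have := digit_le1 (R := R) b => d1 d0.
apply/andP; split; last by rewrite invf_le1; lra.
by rewrite div1r lef_pV2 ?posrE; lra.
Qed.

(** Truncation uses the tail 0, outside $[1/2,1]$, so finite fractions need this larger range; the
    single digit $1/2$ gives 2. *)
Lemma cf_map_ge0_le2 u : 0 <= cf_map u (0 : R) <= 2.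
Proof.
elim: u => [|b u /andP[IH0 IH1]] /=; first by rewrite lexx ler0n.
have := digit_ge (R := R) b => d0.
apply/andP; split; first by rewrite invr_ge0; lra.
by rewrite -[leRHS]invrK lef_pV2 ?posrE ?invr_gt0; lra.
Qed.

(** With $t = (7/6)^n$, growth and $q' \le 2q$ give $q \ge t/3$, so the distance is at most $2/q^2
    \le 18/t^2 \le 18/t$. *)
Lemma cf_map_contract u (x y : R) : 0 <= x <= 2 -> 0 <= y <= 2 ->
  `|cf_map u x - cf_map u y| <= 18 * (6 / 7) ^+ size u.
Proof.
move=> /andP[x0 x2] /andP[y0 y2]; rewrite cf_map_dist//.
have [q0 q'0 q'q] := continuantP (R := R) u.
have := continuant_growth (R := R) u.
have -> : 6 / 7 = (7 / 6 : R)^-1 by field.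
rewrite exprVn; have : 1 <= (7 / 6 : R) ^+ size u by apply: exprn_ege1; lra.
move: ((7 / 6 : R) ^+ size u) => t t1.
move: (continuant u) q0 q'0 q'q => [q q'] /= q0 q'0 q'q tq.
rewrite ler_pdivrMr; last by rewrite mulr_gt0//; nra.
rewrite mulrAC ler_pdivlMr; last lra.
have xy : `|x - y| <= 2 by rewrite ler_norml; lra.
have q3 : t <= 3 * q by lra.
have : q * q <= (q + q' * x) * (q + q' * y) by apply: ler_pM; nra.
nra.
Qed.

Lemma mkseqD b m n :
  mkseq b (m + n) = mkseq b m ++ mkseq (fun i => b (m + i)%N) n.
Proof.
rewrite /mkseq iotaD map_cat; congr (_ ++ _).
by rewrite add0n -[X in iota X _]addn0 iotaDl -map_comp.
Qed.

Definition value b : R := inf_cfrac (fun i => digit (b i)).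

Lemma cfrac_digits b n :
  cfrac (mkseq (fun i => digit (b i)) n) = cf_map (mkseq b n) (0 : R).
Proof.
by rewrite /cfrac /cf_map /mkseq (map_comp (digit (R := R)) b) !foldr_map.
Qed.

Lemma cvg_geo18 : (fun n => 18 * (6 / 7) ^+ n : R) @ \oo --> (0 : R).
Proof.
rewrite -[X in _ --> X](mulr0 18); apply: cvgM; first exact: cvg_cst.
by apply: cvg_expr; rewrite ger0_norm; lra.
Qed.

Lemma cvg_value b : (fun n => cf_map (mkseq b n) (0 : R)) @ \oo --> value b.
Proof.
have -> : value b = limn (fun n => cf_map (mkseq b n) (0 : R)).
  by congr (limn _); apply/funext => n; exact: cfrac_digits.
apply/cauchy_cvgP/cauchy_exP => e e0.
have [n _ hn] : \forall n \near \oo, 18 * (6 / 7) ^+ n < e :> R.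
  by apply: (cvgr_lt (0 : R)) => //; exact: cvg_geo18.
exists (cf_map (mkseq b n) 0); exists n => // m /= nm.
rewrite -ball_normE /= -(subnKC nm) mkseqD cf_map_cat.
apply: le_lt_trans (hn n (leqnn _)).
rewrite -[X in _ ^+ X](size_mkseq b n); apply: cf_map_contract.
  by rewrite lexx ler0n.
exact: cf_map_ge0_le2.
Qed.

Lemma valueS b : value b = (digit (b 0%N) + value (fun i => b i.+1))^-1.
Proof.
have v0 : 0 <= value (fun i => b i.+1).
  rewrite -(cvg_lim (@Rhausdorff R) (cvg_value (fun i => b i.+1))).
  apply: limr_ge; first by apply/cvg_ex; eexists; exact: cvg_value.
  apply: nearW => n.
  by have /andP[] := cf_map_ge0_le2 (mkseq (fun i => b i.+1) n).
apply: (@cvg_unique _ (@Rhausdorff R)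
  ((fun n => cf_map (mkseq b n.+1) 0) @ \oo)).
  by have := cvg_value b; rewrite -cvg_shiftS.
have -> : (fun n => cf_map (mkseq b n.+1) 0) =
    (fun n => (digit (b 0%N) + cf_map (mkseq (fun i => b i.+1) n) 0)^-1 : R).
  by apply/funext => n; rewrite -add1n mkseqD.
apply: cvgV; first by rewrite gt_eqF//; have := digit_ge (R := R) (b 0%N); lra.
by apply: cvgD; [exact: cvg_cst|exact: cvg_value].
Qed.

Lemma value_itv b : 1 / 2 <= value b <= 1.
Proof.
(* Changing the final tail from 0 to 1 does not affect the limit, and with tail 1 every approximant
   lies in $[1/2,1]$. *)
have cv1 : (fun n => cf_map (mkseq b n) (1 : R)) @ \oo --> value b.
  rewrite -[X in _ --> X]add0r.
  rewrite (_ : (fun n => _) = (fun n => cf_map (mkseq b n) (1 : R)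
      - cf_map (mkseq b n) 0) \+ (fun n => cf_map (mkseq b n) 0)); last first.
    by apply/funext => n /=; rewrite subrK.
  apply: cvgD; last exact: cvg_value.
  apply/norm_cvg0P; apply: squeeze_cvgr (cvg_cst _) cvg_geo18.
  apply: nearW => n; rewrite normr_ge0/=.
  rewrite -[X in _ ^+ X](size_mkseq b n).
  by apply: cf_map_contract; rewrite ?lexx ?ler0n// ?ler01 ler1n.
have h n : 1 / 2 <= cf_map (mkseq b n) (1 : R) <= 1.
  by apply: cf_map_itv; lra.
rewrite -(cvg_lim (@Rhausdorff R) cv1); apply/andP; split.
  apply: limr_ge; first by apply/cvg_ex; eexists; exact: cv1.
  by apply: nearW => n; have /andP[] := h n.
apply: limr_le; first by apply/cvg_ex; eexists; exact: cv1.
by apply: nearW => n; have /andP[] := h n.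
Qed.

Lemma value_prefix b n :
  value b = cf_map (mkseq b n) (value (fun i => b (n + i)%N)).
Proof.
elim: n b => [|n IH] b; first by [].
by rewrite -add1n mkseqD cf_map_cat -IH valueS.
Qed.

Lemma value_cyl b n : `|value b - cf_map (mkseq b n) 1| <=
  cyl_length (mkseq b n).
Proof. by rewrite (value_prefix b n); apply: cf_map_cyl; exact: value_itv. Qed.

(** Membership in the closed interval [cf_map u] $[1/2,1]$, tested by stripping digits with the
    inverse branches $y \mapsto 1/y - a$. *)
Fixpoint in_cyl u (y : R) : bool :=
  if u is b :: v then in_cyl v (y^-1 - digit b) else 1 / 2 <= y <= 1.

Lemma value_in_cyl b n : in_cyl (mkseq b n) (value b).
Proof.
elim: n b => [|n IH] b; first exact: value_itv.
rewrite -add1n mkseqD /= valueS invrK [_ + value _]addrC addrK.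
exact: IH.
Qed.

Lemma in_cyl_itv u y : in_cyl u y -> 1 / 2 <= y <= 1.
Proof.
elim: u y => [//|b u IH] y /= /IH /andP[h1 h2].
have d0 := digit_ge (R := R) b; have d1 := digit_le1 (R := R) b.
have yV0 : 0 < y^-1 by lra.
have y0 : 0 < y by rewrite -invr_gt0.
have : y * y^-1 = 1 by rewrite mulfV// gt_eqF.
nra.
Qed.

Definition cyl_sum p n (y : R) : R :=
  \sum_(u <- words n | in_cyl u y) weight p u.

Lemma cyl_sumS p n y : cyl_sum p n.+1 y =
  p 0%N true * cyl_sum (fun i => p i.+1) n (y^-1 - digit true) +
  p 0%N false * cyl_sum (fun i => p i.+1) n (y^-1 - digit false).
Proof.
rewrite /cyl_sum big_mkcond sum_wordsS -!big_mkcond !mulr_sumr.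
by congr (_ + _); apply: eq_bigr => u _; rewrite weight_cons.
Qed.

Lemma cyl_sum_out p n y : ~~ (1 / 2 <= y <= 1) -> cyl_sum p n y = 0.
Proof.
move=> hy; rewrite /cyl_sum big1// => u /in_cyl_itv.
by rewrite (negbTE hy).
Qed.

(* The two cylinders of rank 1 meet only at 2/3, where [cyl_sumS] evaluates its
   terms at the endpoints 1 and 1/2; these lie in one cylinder of each rank. *)
Lemma cyl_sum_le (p : nat -> bool -> R) (c : nat -> R) n y :
  (forall i (b : bool), 0 <= p i b <= c i) ->
  cyl_sum p n y <= 2 * \prod_(i < n) c i /\
  (y = 1 / 2 \/ y = 1 -> cyl_sum p n y <= \prod_(i < n) c i).
Proof.
elim: n p c y => [|n IH] p c y pc.
  rewrite big_ord0 /cyl_sum big_mkcond big_seq1 /weight big_ord0.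
  by case: ifP => _; split => *; lra.
rewrite big_ord_recl cyl_sumS.
have /andP[t0 tc] := pc 0%N true; have /andP[f0 fc] := pc 0%N false.
pose c' i := c i.+1; pose p' i := p i.+1.
have pc' i (b : bool) : 0 <= p' i b <= c' i by exact: pc.
have {}IH z := IH p' c' z pc'.
rewrite -/p'; have -> : \prod_(i < n) c (lift ord0 i) = \prod_(i < n) c' i.
  by apply: eq_bigr.
have P0 : 0 <= \prod_(i < n) c' i.
  by apply: prodr_ge0 => i _; have /andP[] := pc' i true; lra.
move: (\prod_(i < n) c' i) P0 IH => Q Q0 IH.
have c0 : 0 <= c 0%N by lra.
have A0 z : z = 1 / 2 \/ z = 1 ->
    forall b : bool, p 0%N b * cyl_sum p' n z <= c 0%N * Q.
  move=> /(proj2 (IH z)) h b; have /andP[h0 h1] := pc 0%N b.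
  nra.
split; last first.
  (* At $y = 1/2$ only the digit 1 is possible, with tail 1; at $y = 1$ only the digit $1/2$, with
     tail $1/2$. Both tails are endpoints again. *)
  case=> ->.
    rewrite [X in p 0%N true * X]cyl_sum_out /digit.
      by rewrite mulr0 add0r; apply: A0; right; lra.
    by rewrite div1r invrK; apply/negP; lra.
  rewrite [X in p 0%N false * X]cyl_sum_out /digit.
    by rewrite mulr0 addr0; apply: A0; left; lra.
  by rewrite invr1 subrr; apply/negP; lra.
have B0 z (b : bool) : p 0%N b * cyl_sum p' n z <= c 0%N * (2 * Q).
  have [h _] := IH z; have /andP[h0 h1] := pc 0%N b; nra.
have [h1|h1] := boolP (1 / 2 <= y^-1 - digit true <= 1); last first.
  rewrite cyl_sum_out// mulr0 add0r.
  by have := B0 (y^-1 - digit false) false; lra.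
have [h2|h2] := boolP (1 / 2 <= y^-1 - digit false <= 1); last first.
  rewrite [X in p 0%N false * X]cyl_sum_out// mulr0 addr0.
  by have := B0 (y^-1 - digit true) true; lra.
rewrite /digit in h1 h2 *.
have -> : y^-1 - 1 / 2 = 1 by lra.
have -> : y^-1 - 1 = 1 / 2 by lra.
have := A0 1 (or_intror erefl) true; have := A0 _ (or_introl erefl) false; lra.
Qed.

End Value.

(** * Measure-theoretic tools *)

Section MeasureFacts.
Context {R : realType}.

(** A step of length $l \ge 2$ leaves room for one contraction over two ranks; monotonicity covers
    the remaining ranks. *)
Lemma geometric_decay (u : nat -> R) (k : R) (a l : nat) :
  0 <= k -> (1 < l)%N -> u 0%N <= 1 -> (forall n, 0 <= u n) ->
  (forall n, u n.+1 <= u n) ->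
  (forall i, u (a + i * l).+2 <= k * u (a + i * l)%N) ->
  forall i, u (a + i * l)%N <= k ^+ i.
Proof.
move=> k0 l1 u01 u0 uS uk.
have noninc m n : (m <= n)%N -> u n <= u m.
  move=> /subnK <-; elim: (n - m)%N => [//|d IH].
  by rewrite addSn (le_trans (uS _)).
elim=> [|i IH]; first by rewrite expr0 (le_trans (noninc 0%N _ _)).
rewrite exprS; apply: le_trans (ler_wpM2l k0 IH); apply: le_trans (uk i).
by apply: noninc; rewrite mulSn -addn2 -addnA leq_add2l addnC leq_add2r.
Qed.

Lemma measure_bigsetU_le d (T : measurableType d)
    (mu : {measure set T -> \bar R}) (I : Type) (s : seq I) (Q : pred I)
    (F : I -> set T) : (forall i, measurable (F i)) ->
  (mu (\big[setU/set0]_(i <- s | Q i) F i) <= \sum_(i <- s | Q i) mu (F i))%E.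
Proof.
move=> mF; elim: s => [|i s IH]; first by rewrite !big_nil measure0.
rewrite !big_cons; case: ifP => // _.
apply: le_trans (measureU2 _ _ _) _; first exact: mF.
  exact: bigsetU_measurable.
exact: leeD2l.
Qed.

(** Borel-Cantelli, with a geometric series as majorant. *)
Lemma lim_sup_set_geometric d (T : measurableType d)
    (mu : {measure set T -> \bar R}) (F : (set T)^nat) (C k : R) :
  0 <= C -> 0 < k < 1 -> (forall n, measurable (F n)) ->
  (forall n, (mu (F n) <= (C * k ^+ n)%:E)%E) -> mu (lim_sup_set F) = 0%E.
Proof.
move=> C0 /andP[k0 k1] mF Fk; apply: lim_sup_set_cvg0 => //.
apply: le_lt_trans (ltry (C * (1 - k)^-1)).
apply: lime_le; first exact: is_cvg_nneseries.
apply: nearW => n; apply: le_trans (lee_sum _ (fun i _ => Fk i)) _.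
rewrite sumEFin lee_fin.
apply: (geometric_le_lim n C0 k0); by rewrite gtr0_norm.
Qed.

Lemma cdf_continuous d (T : measurableType d) (P : probability T R)
    (X : {RV P >-> R}) :
  (forall r, P (X @^-1` [set r]) = 0%E) -> continuous (cdf X).
Proof.
move=> X0 a; apply/left_right_continuousP; split; last first.
  exact: cdf_right_continuous.
(* The left limits of the distribution function of [X] are right limits of
   that of [- X]. *)
pose Y : {RV P >-> R} := - X.
have YE r : cdf X (- r) = (1 - cdf Y r)%E.
  rewrite /cdf /distribution /pushforward -probability_setC; last first.
    exact: measurable_funPTI.
  have -> : X @^-1` `]-oo, - r] = ~` (Y @^-1` `]-oo, r]) `|` X @^-1` [set - r].
    apply/seteqP; split => w /=; rewrite !in_itv/= lerNl.
      rewrite le_eqVlt => /orP[/eqP ->|h]; first by right.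
      by left; apply/negP; rewrite -ltNge.
    by case=> [/negP|->]; rewrite ?lexx// -ltNge => /ltW.
  rewrite measureU//.
  - by rewrite [X in (_ + X)%E](X0 (- r)) adde0.
  - by apply: measurableC; exact: measurable_funPTI.
  - apply/seteqP; split => // w /= [+ Xw]; apply; rewrite in_itv/=.
    by rewrite lerNl -Xw.
apply/cvg_at_leftNP.
rewrite (_ : cdf X \o -%R = (fun r => 1 - cdf Y r)%E); last first.
  by apply/funext => r; rewrite /= YE.
rewrite -[in X in _ --> X](opprK a) YE; apply: cvgeB => //.
  exact: cvg_cst.
exact: cdf_right_continuous.
Qed.

End MeasureFacts.

(** * The law of the random continued fraction *)

Section RandomDigits.
Context {d : measure_display} {T : measurableType d} {R : realType}.
Context {P : probability T R} (xi : nat -> {RV P >-> R}).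
Context (p : nat -> bool -> R).
Context (xi_indep : independent_RVs xi).
Context (xi_p : forall n b, P (xi n @^-1` [set digit b]) = (p n b)%:E).
Context (p_sum : forall n, p n true + p n false = 1).

Lemma digit_prob_ge0 n b : 0 <= p n b.
Proof. by rewrite -lee_fin -xi_p. Qed.

Definition prefix_event (u : seq bool) : set T :=
  \bigcap_(i in `I_(size u)) (xi i @^-1` [set digit (nth false u i)]).

Lemma measurable_prefix_event u : measurable (prefix_event u).
Proof. by apply: bigcap_measurableType => i _; exact: measurable_funPTI. Qed.

Lemma prefix_event_prob u : P (prefix_event u) = (weight p u)%:E.
Proof.
pose J := [fset i | i in iota 0 (size u)]%fset.
have JE : [set` J] = `I_(size u).
  by apply/seteqP; split => i /=; rewrite !inE /= mem_iota.
rewrite /prefix_event -JE.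
rewrite (xi_indep J (fun i => [set digit (nth false u i)])) //.
have -> : (\prod_(i <- J) P (xi i @^-1` [set digit (nth false u i)]) =
    \prod_(i <- iota 0 (size u)) P (xi i @^-1` [set digit (nth false u i)]))%E.
  apply: perm_big; apply: uniq_perm; rewrite ?fset_uniq ?iota_uniq//.
  by move=> i; rewrite !inE.
under eq_bigr do rewrite xi_p.
by rewrite prodEFin -[in iota _ _](subn0 (size u)) big_mkord.
Qed.

(** Only the probabilities of the two digit values are given, so the [xi n] are digits merely almost
    surely; this is the exceptional event. *)
Definition off_digits : set T :=
  \bigcup_n ~` (xi n @^-1` [set digit true] `|` xi n @^-1` [set digit false]).

Lemma measurable_off_digits : measurable off_digits.
Proof.
apply: bigcup_measurable => n _; apply: measurableC.
by apply: measurableU; exact: measurable_funPTI.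
Qed.

Lemma off_digits_prob : P off_digits = 0%E.
Proof.
apply: measure_negligible; first exact: measurable_off_digits.
apply: negligible_bigcup => n.
have mD b : measurable (xi n @^-1` [set digit b]) by exact: measurable_funPTI.
apply/negligibleP; first by apply: measurableC; exact: measurableU.
rewrite [LHS](probability_setC P); last exact: measurableU.
rewrite measureU//; last first.
  by apply/seteqP; split => // w [/= -> ]; rewrite /digit; lra.
rewrite [X in (_ - (X + _))%E]xi_p [X in (_ - (_ + X))%E]xi_p.
by rewrite -EFinD p_sum subrr.
Qed.

Definition digits_of (w : T) : nat -> bool := fun n => xi n w == digit true.

Lemma digits_ofP w n : ~ off_digits w -> xi n w = digit (digits_of w n).
Proof.
move=> Dw; rewrite /digits_of; case: eqP => // xt.
by apply: contrapT => xf; apply: Dw; exists n => // -[].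
Qed.

Lemma cfrac_RV_value w : ~ off_digits w -> cfrac_RV xi w = value (digits_of w).
Proof.
move=> Dw; congr inf_cfrac; apply/funext => n; exact: digits_ofP.
Qed.

(** Off a null event the fraction is the [value] of its digits, so the event is covered by the
    prefix events of the words satisfying [Q]. *)
Lemma cfrac_RV_prob_le n (C : set R) (Q : pred (seq bool)) : measurable C ->
  (forall b, C (value b) -> Q (mkseq b n)) ->
  (P (cfrac_RV xi @^-1` C) <= (\sum_(u <- words n | Q u) weight p u)%:E)%E.
Proof.
move=> mC CQ.
have mE : measurable (\big[setU/set0]_(u <- words n | Q u) prefix_event u).
  by apply: bigsetU_measurable => u _; exact: measurable_prefix_event.
apply: (@le_trans _ _ (P (off_digits `|`
    \big[setU/set0]_(u <- words n | Q u) prefix_event u))).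
  apply: le_measure; rewrite ?inE; first exact: measurable_funPTI.
    by apply: measurableU => //; exact: measurable_off_digits.
  move=> w /= Cw; have [|Dw] := pselect (off_digits w); [by left|right].
  rewrite cfrac_RV_value// in Cw.
  rewrite -bigcup_seq_cond; exists (mkseq (digits_of w) n).
    by rewrite /= CQ// andbT -{2}(size_mkseq (digits_of w) n) mem_words.
  move=> i; rewrite /= size_mkseq => ltin.
  by rewrite nth_mkseq//; exact: digits_ofP.
apply: le_trans (measureU2 _ measurable_off_digits mE) _.
rewrite [X in (X + _)%E]off_digits_prob add0e -sumEFin.
apply: le_trans (measure_bigsetU_le _ _ _ _ _ _ _ measurable_prefix_event) _.
by apply: lee_sum => u _; rewrite [leLHS]prefix_event_prob.
Qed.

Context (m : R) (a l : nat).
Context (m_gt0 : 0 < m).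
Context (l_gt1 : (1 < l)%N).
Context (p_gem : forall i b, m <= p (a + i * l)%N b).

(** [cyl_sum_le] is applied with [c i] the larger digit probability, which is at most $1 - m$ along
    the progression. *)
Lemma cfrac_RV_no_atom y : P (cfrac_RV xi @^-1` [set y]) = 0%E.
Proof.
pose c i := Num.max (p i true) (p i false).
have pc i b : 0 <= p i b <= c i.
  by rewrite digit_prob_ge0 /= /c le_max; case: b; rewrite lexx ?orbT.
have c1 i : c i <= 1.
  rewrite /c ge_max; have := p_sum i.
  by have := digit_prob_ge0 i true; have := digit_prob_ge0 i false; lra.
have cm i : c (a + i * l)%N <= 1 - m.
  rewrite /c ge_max; have := p_sum (a + i * l)%N.
  by have := p_gem i true; have := p_gem i false; lra.
have c0 i : 0 <= c i by have /andP[] := pc i true; lra.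
have m1 : 0 <= 1 - m by rewrite (le_trans (c0 _) (cm 0%N)).
pose B n := \prod_(i < n) c i.
have B0 n : 0 <= B n by apply: prodr_ge0.
have BS n : B n.+1 <= B n by rewrite /B big_ord_recr /= ler_piMr// B0.
have decay := geometric_decay B (1 - m) a l m1 l_gt1.
have {}decay i : B (a + i * l)%N <= (1 - m) ^+ i.
  apply: decay => //; first by rewrite /B big_ord0.
  (* Here a single rank contracts; the other one is absorbed by monotonicity. *)
  move=> j; apply: le_trans (BS _) _.
  by rewrite {1}/B big_ord_recr /= mulrC; apply: ler_wpM2r; rewrite ?B0.
apply/eqP; rewrite eq_le measure_ge0 andbT.
have bound i : (P (cfrac_RV xi @^-1` [set y]) <= (2 * (1 - m) ^+ i)%:E)%E.
  apply: le_trans (cfrac_RV_prob_le (a + i * l) _ (fun u => in_cyl u y) _ _) _.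
  - by [].
  - by move=> b /= <-; exact: value_in_cyl.
  rewrite lee_fin; have [+ _] := cyl_sum_le p c (a + i * l) y pc.
  by move=> /le_trans; apply; apply: ler_wpM2l => //; exact: decay.
have cvg0 : (fun i => (2 * (1 - m) ^+ i)%:E) @ \oo --> 0%E.
  apply: cvg_EFin; first exact: nearW.
  rewrite -[X in _ --> X](mulr0 2); apply: cvgM; first exact: cvg_cst.
  by apply: cvg_expr; rewrite ger0_norm// gtrBl.
rewrite -(cvg_lim _ cvg0)//; apply: lime_ge; first by apply/cvg_ex; exists 0%E.
exact: nearW.
Qed.

(* A ball containing the cylinder of [u], of twice its length; using it instead
   of the cylinder avoids the monotonicity of [cf_map u]. *)
Definition heavy_cyl u : set R :=
  `[cf_map u 1 - cyl_length u, cf_map u 1 + cyl_length u].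

Definition heavy n : set R :=
  \big[setU/set0]_(u <- words n | cyl_length u <= weight p u) heavy_cyl u.

Lemma measurable_heavy n : measurable (heavy n).
Proof. by apply: bigsetU_measurable => u _; exact: measurable_itv. Qed.

(** When $|u| \le P(u)$, the length $|u|$ is at most the geometric mean $\sqrt{P(u)|u|}$; the balls
    have length $2|u|$. *)
Lemma heavy_lebesgue n : (lebesgue_measure (heavy n) <= (2 * Hell p n)%:E)%E.
Proof.
apply: le_trans (measure_bigsetU_le _ _ _ _ _ _ _ _) _.
  by move=> u; exact: measurable_itv.
rewrite /Hell mulr_sumr -sumEFin big_mkcond; apply: lee_sum => u _.
have l0 := cyl_length_gt0 (R := R) u.
case: ifP => uw; last by rewrite lee_fin mulr_ge0// sqrtr_ge0.
rewrite [leLHS]lebesgue_measure_itv /= lte_fin ifT; last lra.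
rewrite -EFinD lee_fin.
have : cyl_length u <= hell p u.
  rewrite /hell -[leLHS]ger0_norm ?(ltW l0)// -sqrtr_sqr ler_wsqrtr// expr2.
  by apply: ler_wpM2r => //; exact: ltW.
lra.
Qed.

(** Dually, for the other words $P(u) < |u|$, so $P(u)$ is at most the same geometric mean. *)
Lemma heavy_prob n :
  (P (cfrac_RV xi @^-1` ~` heavy n) <= (Hell p n)%:E)%E.
Proof.
pose light u := weight p u < cyl_length u.
apply: le_trans (cfrac_RV_prob_le n _ light _ _) _.
- by apply: measurableC; exact: measurable_heavy.
- move=> b /= nh; rewrite /light ltNge; apply/negP => h; apply: nh.
  rewrite /heavy -bigcup_seq_cond; exists (mkseq b n).
    by rewrite /= h andbT -{2}(size_mkseq b n) mem_words.
  rewrite /heavy_cyl /= in_itv /=.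
  by have := value_cyl (R := R) b n; rewrite ler_distl.
rewrite lee_fin big_mkcond; apply: ler_sum => u _.
case: ifP => [/ltW h|_]; last exact: sqrtr_ge0.
have w0 := weight_ge0 p digit_prob_ge0 u.
rewrite /hell -[leLHS]ger0_norm// -sqrtr_sqr ler_wsqrtr// expr2.
exact: ler_wpM2l.
Qed.

Lemma cfrac_RV_singular : singular_distribution (cfrac_RV xi).
Proof.
split; first by apply: cdf_continuous; exact: cfrac_RV_no_atom.
pose k : R := 1 - m / 3 * ((1 / 418) ^+ 2 / 8).
have m1 : m <= 1.
  have := p_gem 0 true; have := p_sum (a + 0 * l).
  by have := digit_prob_ge0 (a + 0 * l) false; lra.
have k01 : 0 < k < 1.
  have : 0 < (1 / 418 : R) ^+ 2 / 8 < 1 by rewrite expr2; lra.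
  by rewrite /k; move: (_ / 8) m_gt0 => e + /andP[]; nra.
have p0 := digit_prob_ge0.
have decay i : Hell p (a + i * l) <= k ^+ i.
  apply: geometric_decay => //.
  - lra.
  - exact: Hell_le1.
  - by move=> n; exact: Hell_ge0.
  - by move=> n; exact: HellS_le.
  - by move=> j; apply: HellSS_le => //; exact: ltW.
pose F i := heavy (a + i * l).
have mF i : measurable (F i) by exact: measurable_heavy.
have mN : measurable (lim_sup_set F).
  by apply: bigcapT_measurable => n; exact: bigcup_measurable.
exists (lim_sup_set F); split => //.
  apply: (lim_sup_set_geometric _ _ _ _ 2 k) => // n.
  apply: le_trans (heavy_lebesgue _) _.
  by rewrite lee_fin; apply: ler_wpM2l.
(* The complements are summable for [P] too, so almost surely the fraction lies in all late [F i],
   hence in their upper limit. *)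
pose F' i := cfrac_RV xi @^-1` ~` F i.
have mF' i : measurable (F' i).
  by apply: measurable_funPTI; exact: measurableC.
have F'0 : P (lim_sup_set F') = 0%E.
  apply: (lim_sup_set_geometric _ _ _ _ 1 k) => // n.
  by apply: le_trans (heavy_prob _) _; rewrite lee_fin mul1r.
have mX : measurable (cfrac_RV xi @^-1` lim_sup_set F).
  exact: measurable_funPTI.
have X0 : P (~` (cfrac_RV xi @^-1` lim_sup_set F)) = 0%E.
  apply: subset_measure0 F'0 => //.
  - exact: measurableC.
  - by apply: bigcapT_measurable => n; exact: bigcup_measurable.
  move=> w /= nw n _; apply: contrapT => h; apply: nw => j _.
  exists (maxn n j); first exact: leq_maxr.
  apply: contrapT => nF; apply: h; exists (maxn n j) => //.
  exact: leq_maxl.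
rewrite /distribution /pushforward /= -[X in P X]setCK probability_setC.
  by rewrite X0 sube0.
exact: measurableC.
Qed.

End RandomDigits.

(* All sequences are indexed from 0: xi n, p n, q i stand for the terms of
   index n + 1, i + 1. *)
Theorem theorem4 (R : realType) (d : measure_display) (T : measurableType d)
    (P : probability T R) (xi : nat -> {RV P >-> R}) (phalf pone : nat -> R)
    (M L : nat) (qhalf qone : 'I_L -> R) :
  independent_RVs xi ->
  (forall n, P (xi n @^-1` [set 1 / 2]) = (phalf n)%:E) ->
  (forall n, P (xi n @^-1` [set 1]) = (pone n)%:E) ->
  (forall n, pone n = 1 - phalf n) ->
  (0 < L)%N ->
  (forall i, [/\ 0 <= qhalf i, 0 <= qone i & qhalf i + qone i = 1]) ->
  (forall (j : nat) (i : 'I_L), phalf (M + j * L + i)%N = qhalf i) ->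
  (exists j, 0 < qhalf j < 1) ->
  \prod_(j < L) (qhalf j `^ (ln (25 / 24) / ln (10 / 9)) *
                 qone j `^ (1 - ln (25 / 24) / ln (10 / 9)))
    != expR (- (2 * Gconst R * L%:R)) ->
  singular_distribution (cfrac_RV xi).
Proof.
move=> indep ph po poE L0 q01 period [j /andP[q0 q1]] _.
pose p n (b : bool) := if b then phalf n else pone n.
(* The progression advances by $2L$ rather than $L$ so that its step exceeds 1 even when $L = 1$. *)
have Mj i : (M + j + i * (2 * L) = M + (2 * i) * L + j)%N by lia.
apply: (cfrac_RV_singular xi p indep _ _ (Num.min (qhalf j) (1 - qhalf j))
  (M + j) (2 * L)).
- by move=> n [].
- by move=> n; rewrite /p poE; lra.
- by rewrite lt_min; lra.
- lia.
- move=> i b; rewrite Mj /p poE period.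
  by case: b; rewrite ge_min lexx ?orbT.
Qed.
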